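(* Let $G$ be a finite insoluble group and $x$ an element of $G$. Then the cardinality of $\mathrm{Sol}_G(x)$ is not equal to $p^2$ for any prime $p$.
   Context: For a finite group $G$ and $x \in G$, the solubilizer of $x$ in $G$ is the subset $\mathrm{Sol}_G(x)=\{y \in G \mid \langle x,y\rangle \text{ is soluble}\}$ (not a subgroup in general). Insoluble means not soluble. *)

(* Defs.v *)
From mathcomp Require Import all_boot all_fingroup all_solvable.

Set Implicit Arguments.
Unset Strict Implicit.
Unset Printing Implicit Defensive.

Local Open Scope group_scope.

(** [solubilizer G x] is Sol_G(x); it need not be a subgroup of [G], hence a [{set gT}]. *)
Definition solubilizer (gT : finGroupType) (G : {set gT}) (x : gT) : {set gT} :=
  [set y in G | solvable <<[set x; y]>>].

(* Main.v *)
(** [Sol_G(x)] is stable under left and right multiplication by [X = <x>], so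
    the action of [X] by right translation on the right cosets of [X] in
    [Sol_G(x)] gives |Sol_G(x) : X| = |N_G(X) : X| modulo p. If |Sol_G(x)| = p^2
    then [X] is a nontrivial p-group, so both indices lie in {1, .., p} and
    hence are equal: [Sol_G(x) = N_G(X)] is an abelian p-group P containing
    every soluble subgroup through [x]. Thus P is a self-normalizing Sylow
    subgroup and Burnside's transfer theorem yields a normal complement N; by
    coprime action P normalizes a Sylow q-subgroup Q of N for each prime q, so
    that [QP], being soluble, lies in P. Hence N = 1 and G = P is soluble. *)

Require Import Defs.
From mathcomp Require Import all_boot all_fingroup all_solvable.
From mathcomp Require Import ssralg.

Set Implicit Arguments.
Unset Strict Implicit.
Unset Printing Implicit Defensive.

Local Open Scope group_scope.

Section BurnsideTransfer.

Variables (gT : finGroupType) (p : nat) (G S : {group gT}).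
Hypotheses (sylS : p.-Sylow(G) S) (cNS : 'N_G(S) \subset 'C(S)).

Let sSG : S \subset G := pHall_sub sylS.

Let abelS : abelian S.
Proof. by apply: subset_trans cNS; rewrite subsetI sSG normG. Qed.

(** As [S] is abelian, [S] and [S :^ t] both centralize [g ^ t], so they are Sylow subgroups of its
    centralizer [C] and some [c] in [C] conjugates one to the other. Then [t * c^-1] normalizes [S],
    hence fixes [g], while [c] fixes [g ^ t]. *)
Lemma Burnside_fusion g t : t \in G -> g \in S -> g ^ t \in S -> g ^ t = g.
Proof.
move=> Gt Sg Sgt; pose C := 'C_G[g ^ t]%G.
have sCG: C \subset G by apply: subsetIl.
have sSC: S \subset C.
  by rewrite subsetI sSG; apply/subsetP=> s Ss; apply/cent1P/(centsP abelS).
have sStC: (S :^ t)%G \subset C.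
  rewrite subsetI /= conj_subG //= -cent_cycle cycleJ centJ conjSg cent_cycle.
  by apply/subsetP=> s Ss; apply/cent1P/(centsP abelS).
have sylStC: p.-Sylow(C) (S :^ t)%G.
  by apply: pHall_subl sStC sCG _; rewrite /= pHallJ.
have [c Cc defS] := Sylow_trans (pHall_subl sSC sCG sylS) sylStC.
have {Cc} [Gc Cgc] := setIP Cc.
have /(subsetP cNS)/centP/(_ g Sg) cg: t * c^-1 \in 'N_G(S).
  rewrite inE groupM ?groupV //=; apply/normP.
  by rewrite conjsgM [S :^ t]defS conjsgK.
have: g ^ (t * c^-1) = g by rewrite conjgE -cg mulKg.
rewrite conjgM; move: Cgc; rewrite -groupV.
by move=> /cent1P/commute_sym/commgP/conjg_fixP->.
Qed.

(** The complement is the kernel of the transfer [V] from [G] to [S]: on [S] it is the power map of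
    exponent [#|G : S|], injective because this index is coprime to [#|S|]. *)
Lemma Burnside_normal_complement : exists N : {group gT}, N ><| S = G.
Proof.
have abelA : abelian (idm_morphism S @* S) by rewrite morphim_abelian.
have memA g : g \in S -> g \in (idm_morphism S @* S)%G.
  by rewrite /= morphim_idm.
pose V := transfer_morphism G abelA.
have coSi: coprime #|S| #|G : S|.
  by have /and3P[_ pS p'S] := sylS; apply: pnat_coprime pS p'S.
have VS g : g \in S -> V g = (FiniteModule.fmod abelA g *+ #|G : S|)%R.
  move=> Sg; have Gg := subsetP sSG g Sg.
  have parX := rcosets_cycle_partition sSG Gg.
  have trX := transversalP parX; set X := transversal _ _ in trX.
  (* Each factor of the expansion is a conjugate in [S] of a power [g ^+ n], so by fusion it is
     [g ^+ n] itself; the exponents [n] add up to [#|G : S|]. *)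
  rewrite /= (transfer_cycle_expansion sSG abelA Gg trX).
  rewrite -(sum_index_rcosets_cycle sSG Gg trX) -GRing.sumrMnr.
  apply: eq_bigr => y Xy; set n := #|_ : _|.
  have Gy : y \in G := subsetP (transversal_sub trX) y Xy.
  have Sgn : (g ^+ n) ^ y^-1 \in S.
    by rewrite conjgE invgK mulgA -mem_rcoset mulg_exp_card_rcosets.
  rewrite (Burnside_fusion _ _ Sgn) ?groupV ?groupX //= /restrm /=.
  exact: FiniteModule.fmodX (memA g Sg).
have tiKS: 'ker V :&: S = 1.
  apply/trivgP/subsetP=> g /setIP[/mker Vg1 Sg].
  have Sgn := memA _ (groupX #|G : S| Sg).
  rewrite inE -(expgK coSi Sg) -(FiniteModule.fmodK abelA Sgn).
  by rewrite (FiniteModule.fmodX _ _ (memA g Sg)) -VS // Vg1 expg1n.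
exists ('ker V)%G; rewrite sdprodE //; last first.
  by rewrite (subset_trans sSG) // ker_norm.
(* By counting, it remains to see that the image of [V] has at most [#|S|] elements. *)
apply/eqP; rewrite eqEcard mul_subG ?subsetIl //= TI_cardMg //.
rewrite -(LagrangeI G ('ker V)) (setIidPr (subsetIl _ _)) leq_mul2l.
rewrite -[G in #|G : _|]setIid -card_morphim orbC.
have sVS: V @* G \subset FiniteModule.fmod abelA @: S.
  apply/subsetP=> u _; apply/imsetP; exists (val u); last first.
    by rewrite FiniteModule.fmvalK.
  by have := FiniteModule.fmodP u; rewrite /= morphim_idm.
by rewrite (leq_trans (subset_leq_card sVS)) ?leq_imset_card.
Qed.

End BurnsideTransfer.

(** Lagrange for a mere set [S]: being stable under [X] on the left, it is a disjoint union of right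
    cosets of [X]. *)
Lemma card_mul_closed (gT : finGroupType) (X : {group gT}) (S : {set gT}) :
  X * S \subset S -> #|S| = (#|S : X| * #|X|)%N.
Proof.
move=> XS; apply: card_uniform_partition.
  by move=> _ /rcosetsP[y Sy ->]; rewrite card_rcoset.
have /and3P[_ tiX nz] := rcosets_partition (subsetT X).
have sR: rcosets X S \subset rcosets X setT by rewrite imsetS ?subsetT.
apply/and3P; split; last by apply: contra nz; apply: subsetP.
  rewrite eqEsubset; apply/andP; split.
    apply/bigcupsP=> _ /rcosetsP[y Sy ->].
    by rewrite (subset_trans _ XS) // mulgS ?sub1set.
  apply/subsetP=> y Sy; apply/bigcupP; exists (X :* y).
    by apply/rcosetsP; exists y.
  exact: rcoset_refl.
exact: trivIsetS tiX.
Qed.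

(** A coset [X :* y] is fixed under right translation by [X] exactly when [y] normalizes [X]. *)
Lemma index_norm_mod (gT : finGroupType) (p : nat) (X : {group gT})
    (S : {set gT}) :
  p.-group X -> S * X \subset S -> #|S : X| = #|'N_S(X) : X| %[mod p].
Proof.
move=> pX SX; rewrite /indexg -afixRs_rcosets; apply: pgroup_fix_mod => //.
apply/actsP=> x Xx Y; apply/rcosetsP/rcosetsP => [][y Sy].
  rewrite /= rcosetE => /(canRL (rcosetK _)) ->; exists (y * x^-1).
    by rewrite (subsetP SX) // mem_mulg ?groupV.
  by rewrite rcosetM.
move=> ->; exists (y * x); first by rewrite (subsetP SX) // mem_mulg.
by rewrite /= rcosetE rcosetM.
Qed.

Lemma solvable_joing (gT : finGroupType) (H K : {group gT}) :
  K \subset 'N(H) -> solvable H -> solvable K -> solvable (H <*> K).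
Proof.
move=> nHK solH solK; have nsH: H <| H <*> K by rewrite normalYl.
by rewrite (series_sol nsH) solH quotientYidl // quotient_sol.
Qed.

Section Solubilizer.

Variables (gT : finGroupType) (G : {group gT}) (x : gT).

Lemma solubilizer_mul_cycle y a b : x \in G ->
    a \in <[x]> -> b \in <[x]> -> y \in solubilizer G x ->
  a * y * b \in solubilizer G x.
Proof.
move=> Gx Xa Xb; rewrite !inE => /andP[Gy solxy].
have sXG: <[x]> \subset G by rewrite cycle_subG.
rewrite !groupM ?(subsetP sXG a) ?(subsetP sXG b) //=.
have sX: <[x]> \subset <<[set x; y]>> by rewrite genS // subsetUl.
apply: solvableS solxy; rewrite gen_subG subUset !sub1set.
rewrite mem_gen ?set21 //= !groupM ?(subsetP sX a) ?(subsetP sX b) //.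
by rewrite mem_gen ?set22.
Qed.

Lemma sub_solubilizer (H : {group gT}) :
  H \subset G -> solvable H -> x \in H -> H \subset solubilizer G x.
Proof.
move=> sHG solH Hx; apply/subsetP=> y Hy; rewrite inE (subsetP sHG) //=.
by apply: solvableS solH; rewrite gen_subG subUset !sub1set Hx.
Qed.

Lemma norm_cycle_sub_solubilizer : 'N_G(<[x]>) \subset solubilizer G x.
Proof.
apply/subsetP=> y /setIP[Gy Ny]; rewrite inE Gy.
apply: (@solvableS _ (<[x]> <*> <[y]>)%G).
  by rewrite gen_subG subUset !sub1set !mem_gen // inE cycle_id ?orbT.
have nXY: <[y]> \subset 'N(<[x]>) by rewrite cycle_subG.
by rewrite solvable_joing ?abelian_sol ?cycle_abelian.
Qed.

Lemma solubilizer_card_prime_sq (p : nat) :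
    ~~ solvable G -> x \in G -> prime p -> #|solubilizer G x| = (p ^ 2)%N ->
  solubilizer G x = 'N_G(<[x]>).
Proof.
move=> nsolG; set S := solubilizer G x => Gx p_pr cardS.
pose P := 'N_G(<[x]>)%G.
have sSG: S \subset G by apply/subsetP=> y /setIdP[].
have sPS: P \subset S := norm_cycle_sub_solubilizer.
have XS: <[x]> * S \subset S.
  apply/subsetP=> _ /mulsgP[a y Xa Sy ->].
  by rewrite -[_ * _]mulg1 solubilizer_mul_cycle.
have SX: S * <[x]> \subset S.
  apply/subsetP=> _ /mulsgP[y b Sy Xb ->].
  by rewrite -[y]mul1g solubilizer_mul_cycle.
have sXP: <[x]> \subset P by rewrite subsetI cycle_subG Gx normG.
have solpG (H : {group gT}) : #|H| %| p ^ 2 -> solvable H.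
  move=> dvH; apply: (@pgroup_sol _ p).
  by rewrite /pgroup (pnat_dvd dvH) // pnatX pnat_id.
have defNS: 'N_S(<[x]>) = P.
  by apply/eqP; rewrite eqEsubset setSI // subsetI sPS subsetIr.
have cardSX : #|S| = (#|S : <[x]>| * #|<[x]>|)%N by apply: card_mul_closed.
have pX: p.-group <[x]>.
  rewrite /pgroup (@pnat_dvd _ (p ^ 2)) ?pnatX ?pnat_id //.
  by rewrite -cardS cardSX dvdn_mull.
have := index_norm_mod pX SX; rewrite defNS => modP.
(* If [x = 1], each subgroup generated by [x] and [y] is cyclic, so [S = G] would have order [p ^ 2]
   and be solvable. *)
have ltX: 1 < #|<[x]>|.
  rewrite cardG_gt1 cycle_eq1; apply: contra nsolG => /eqP x1.
  apply: solpG; rewrite -cardS; suffices <-: S = G by [].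
  apply/eqP; rewrite eqEsubset sSG; apply/subsetP=> y Gy; rewrite inE Gy /= x1.
  apply: (@solvableS _ <[y]>%G); last by rewrite abelian_sol ?cycle_abelian.
  by rewrite gen_subG subUset !sub1set /= group1 cycle_id.
have leSXp: #|S : <[x]>| <= p.
  have [[|k] oX] := p_natP pX; first by rewrite oX in ltX.
  rewrite -(leq_pmul2r (cardG_gt0 <[x]>)) -cardSX cardS oX -expnS.
  by rewrite leq_pexp2l ?prime_gt0.
apply/esym/eqP; rewrite eqEcard sPS cardSX -(Lagrange sXP) mulnC leq_mul2l.
have gt0 : 0 < #|P : <[x]>| by rewrite indexg_gt0.
have leP : #|P : <[x]>| <= #|S : <[x]>| by rewrite subset_leq_card ?imsetS.
(* Below [p], congruent indices are equal. If [#|S : <[x]>|] is [p], then [p] divides the positive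
   number [#|P : <[x]>|], which is therefore at least [p]. *)
move: leSXp modP; rewrite leq_eqVlt => /predU1P[-> | ltp]; last first.
  rewrite !modn_small // => [->|]; first by rewrite leqnn orbT.
  exact: (leq_ltn_trans leP ltp).
by rewrite modnn => /esym/eqP/dvdn_leq->; rewrite ?orbT.
Qed.

Lemma abelian_pgroup_solvable_overgroups (p : nat) (P : {group gT}) :
    P \subset G -> p.-group P -> abelian P -> x \in P ->
    (forall H : {group gT},
       H \subset G -> solvable H -> x \in H -> H \subset P) ->
  G :=: P.
Proof.
move=> sPG pP abelP Px maxP.
have sylP: p.-Sylow(G) P.
  have [Q sylQ sPQ] := Sylow_superset sPG pP.
  suffices ->: P = Q by [].
  apply/val_inj/eqP; rewrite eqEsubset sPQ /=.
  have [sQG pQ _] := and3P sylQ.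
  by rewrite maxP ?(pgroup_sol pQ) ?(subsetP sPQ).
(* For [y] normalizing [P], the group [P <*> <[y]>] is solvable and contains [x], so [y] lies in the
   abelian group [P]. *)
have cNP: 'N_G(P) \subset 'C(P).
  apply: subset_trans (abelP); apply/subsetP=> y /setIP[Gy Ny].
  have nPY: <[y]> \subset 'N(P) by rewrite cycle_subG.
  suffices: P <*> <[y]> \subset P.
    by rewrite join_subG cycle_subG => /andP[].
  apply: maxP; first by rewrite join_subG sPG cycle_subG.
    apply: solvable_joing nPY _ (abelian_sol (cycle_abelian y)).
    exact: abelian_sol abelP.
  by apply: (subsetP (joing_subl _ _)).
have [N defG] := Burnside_normal_complement sylP cNP.
have [/= nsNG _ mulNP nNP tiNP] := sdprod_context defG.
suffices N1: N :=: 1 by rewrite -mulNP N1 mul1g.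
have sNG := normal_sub nsNG.
have coNP: coprime #|N| #|P|.
  have <- : #|G : P| = #|N|.
    by rewrite -divgS // -(sdprod_card defG) mulnK.
  by have [_ _ p'P] := and3P sylP; rewrite coprime_sym (pnat_coprime pP).
apply/eqP/idPn => ntN.
(* The prime is a divisor of [#|N|], so [Q] cannot be trivial; yet maximality of [P] will force [Q]
   into the trivial intersection of [N] and [P]. *)
have [Q sylQ nQP] :=
  sol_coprime_Sylow_exists (pdiv #|N|) (abelian_sol abelP) nNP coNP.
have [sQN qQ _] := and3P sylQ.
have sQP: Q \subset P.
  suffices: Q <*> P \subset P by rewrite join_subG => /andP[].
  apply: maxP; first by rewrite join_subG sPG (subset_trans sQN).
    exact: solvable_joing nQP (pgroup_sol qQ) (abelian_sol abelP).
  by apply: (subsetP (joing_subr _ _)).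
have Q1: Q :=: 1 by apply/trivgP; rewrite -tiNP subsetI sQN.
have := card_Hall sylQ; rewrite Q1 cards1 => /eqP.
by rewrite eq_sym p_part_eq1 pi_pdiv cardG_gt1 ntN.
Qed.

End Solubilizer.

Theorem theoremB (gT : finGroupType) (G : {group gT}) (x : gT)
    (insolG : ~~ solvable G) (Gx : x \in G) (p : nat) (p_pr : prime p) :
  #|solubilizer G x| <> (p ^ 2)%N.
Proof.
move=> cardS; have defS := solubilizer_card_prime_sq insolG Gx p_pr cardS.
have cardP: #|'N_G(<[x]>)| = (p ^ 2)%N by rewrite -defS.
have abelP := card_p2group_abelian p_pr cardP.
case/negP: insolG; suffices ->: G :=: 'N_G(<[x]>) by apply: abelian_sol.
apply: (@abelian_pgroup_solvable_overgroups _ _ x p) => //.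
- exact: subsetIl.
- by rewrite /pgroup cardP pnatX pnat_id.
- by rewrite -cycle_subG subsetI cycle_subG Gx normG.
- by move=> H sHG solH Hx; have:= sub_solubilizer sHG solH Hx; rewrite defS.
Qed.
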